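(* Let $k$ be a field and let $G$ be a finite simple graph. If $G$ admits an edge cover $X=\{E_i\}_{i=1}^\ell$ such that the edges of $X$ are pairwise clique-adjacent (i.e. $X$ is $K_\ell$-connected), then $\operatorname{ms}(k(G))\le\ell$.
   Context: Let $G$ have vertex set $[n]=\{1,\dots,n\}$. The edge ring of $G$ over $k$ is $k(G)=k[x_1,\dots,x_n]/I(G)$, where $I(G)=(x_ix_j\mid\{i,j\}\text{ is an edge of }G)$; it is standard graded with homogeneous maximal ideal $\bar{\mathfrak m}$ (the image of $(x_1,\dots,x_n)$). For a homogeneous ideal $J$ of $k(G)$, $\mu(J)=\dim_k(J/\bar{\mathfrak m}J)$, and $\operatorname{ms}(k(G))=\min\{\mu(J): J\subseteq \bar{\mathfrak m}\text{ homogeneous with }J\supseteq \bar{\mathfrak m}^2\}$. An edge cover of $G$ is a collection of edges $E_1,\dots,E_\ell$ of $G$ with $[n]=\bigcup_{i=1}^\ell E_i$. Two edges $E_i,E_j$ are clique-adjacent if either (a) there are vertices $v\in E_i$ and $w\in E_j$ such that $\{v,w\}$ is an edge of $G$, or (b) $E_i\cap E_j\ne\emptyset$. The collection is $K_\ell$-connected if every pair $E_i,E_j$ is clique-adjacent. *)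

(* Defs.v *)
From HB Require Import structures.
From mathcomp Require Import all_boot all_order all_algebra ring_quotient.
From mathcomp Require Import boolp.
From mathcomp Require Import mpoly.

Set Implicit Arguments.
Unset Strict Implicit.
Unset Printing Implicit Defensive.

Import GRing.Theory.
Local Open Scope ring_scope.
Local Open Scope quotient_scope.

Section Ideals.
Variable R : comNzRingType.
Implicit Types (S I J : R -> Prop).

Definition is_ideal J : Prop :=
  [/\ J 0, forall f g, J f -> J g -> J (f + g) & forall a f, J f -> J (a * f)].

Definition ideal_gen S : R -> Prop := fun f =>
  exists (m : nat) (a s : 'I_m -> R),
    (forall i, S (s i)) /\ f = \sum_i a i * s i.

Definition ideal_mul I J : R -> Prop :=
  ideal_gen (fun f => exists g h, [/\ I g, J h & f = g * h]).

Lemma ideal_gen_sub S f : S f -> ideal_gen S f.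
Proof.
by move=> Sf; exists 1%N, (fun=> 1), (fun=> f); rewrite big_ord1 mul1r.
Qed.

Lemma ideal_gen_ideal S : is_ideal (ideal_gen S).
Proof.
split.
- by exists 0%N, (fun=> 0), (fun=> 0); split; [case | rewrite big_ord0].
- move=> _ _ [m [a [s [Ss ->]]]] [p [b [t [St ->]]]]; exists (m + p)%N.
  exists (fun i => match split i with inl j => a j | inr j => b j end).
  exists (fun i => match split i with inl j => s j | inr j => t j end).
  split=> [i|]; first by case: (split i).
  rewrite big_split_ord /=; congr (_ + _); apply: eq_bigr => i _.
    by rewrite -[lshift _ _]/(unsplit (inl i)) unsplitK.
  by rewrite -[rshift _ _]/(unsplit (inr i)) unsplitK.
- move=> c _ [m [a [s [Ss ->]]]]; exists m, (fun i => c * a i), s.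
  by split=> //; rewrite mulr_sumr; apply: eq_bigr => i _; rewrite mulrA.
Qed.

Lemma ideal_gen_min S J f :
  is_ideal J -> (forall g, S g -> J g) -> ideal_gen S f -> J f.
Proof.
move=> [J0 JD JM] SJ [m [a [s [Ss ->]]]].
by elim/big_ind: _ => // i _; apply/JM/SJ.
Qed.

End Ideals.

(* [dim_quot V W d] : the quotient of the subspace [V] by the subspace [W]
   has a basis with [d] elements, represented by vectors [b i] of [V]. *)
Definition dim_quot (k : fieldType) (M : lmodType k) (V W : M -> Prop)
    (d : nat) : Prop :=
  exists b : 'I_d -> M, (forall i, V (b i)) /\
    forall f, V f ->
      exists! c : {ffun 'I_d -> k}, W (f - \sum_i c i *: b i).

Section EdgeRing.
Variables (k : fieldType) (n : nat) (e : rel 'I_n).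
Local Notation S := {mpoly k[n]}.

Definition edge_gen (f : S) : Prop := exists i j, e i j /\ f = 'X_i * 'X_j.

(* Classical decision turns the ideal I(G) into the boolean predicate that
   the quotient construction expects. *)
Definition edge_ideal (f : S) : bool := `[< ideal_gen edge_gen f >].

Lemma edge_ideal_closed : idealr_closed edge_ideal.
Proof.
have [I0 ID IM] := ideal_gen_ideal edge_gen.
split.
- exact/asboolP.
- apply/asboolP => -[m [a [s [Ss /(congr1 (meval (fun=> 0)))]]]].
  rewrite meval1 raddf_sum big1 ?mulr1 => [|i _].
    by move/eqP; rewrite oner_eq0.
  by have [u [v [_ ->]]] := Ss i; rewrite /= !mevalM !mevalXU !mulr0.
- by move=> a f g /asboolP If /asboolP Ig; apply/asboolP/ID => //; apply: IM.
Qed.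

HB.instance Definition _ := isIdealr.Build S edge_ideal edge_ideal_closed.

Definition edge_idealr : idealr S := Idealr.clone S edge_ideal _.

Definition edge_ring : Type := {ideal_quot edge_idealr}.

HB.instance Definition _ := GRing.ComNzRing.on edge_ring.

Definition edge_pi (p : S) : edge_ring := \pi_({ideal_quot edge_idealr}) p.

Lemma edge_pi_is_zmod_morphism : zmod_morphism edge_pi.
Proof. exact: pi_is_zmod_morphism. Qed.

Lemma edge_pi_is_monoid_morphism : monoid_morphism edge_pi.
Proof. exact: pi_is_monoid_morphism. Qed.

HB.instance Definition _ :=
  GRing.isZmodMorphism.Build S edge_ring edge_pi edge_pi_is_zmod_morphism.
HB.instance Definition _ :=
  GRing.isMonoidMorphism.Build S edge_ring edge_pi edge_pi_is_monoid_morphism.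

Lemma edge_pi_surj (f : edge_ring) : exists p, f = edge_pi p.
Proof. by exists (repr f); rewrite /edge_pi reprK. Qed.

Lemma edge_pi_eq0 (p : S) : edge_pi p = 0 <-> ideal_gen edge_gen p.
Proof.
rewrite -(raddf0 edge_pi) /edge_pi; split=> [/eqP|Ip].
  by rewrite -Quotient.idealrBE subr0 => /asboolP.
by apply/eqP; rewrite -Quotient.idealrBE subr0; apply/asboolP.
Qed.

Definition edge_scale (c : k) (f : edge_ring) : edge_ring :=
  edge_pi c%:MP * f.

Fact edge_scaleA a b f : edge_scale a (edge_scale b f) = edge_scale (a * b) f.
Proof. by rewrite /edge_scale mulrA -rmorphM /= -mpolyCM. Qed.
Fact edge_scale1 : left_id 1 edge_scale.
Proof. by move=> f; rewrite /edge_scale rmorph1 mul1r. Qed.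
Fact edge_scaleDr : right_distributive edge_scale +%R.
Proof. by move=> a f g; rewrite /edge_scale mulrDr. Qed.
Fact edge_scaleDl f : {morph edge_scale^~ f : a b / a + b}.
Proof. by move=> a b; rewrite /edge_scale mpolyCD raddfD /= mulrDl. Qed.

HB.instance Definition _ := GRing.Zmodule_isLmodule.Build k edge_ring
  edge_scaleA edge_scale1 edge_scaleDr edge_scaleDl.

(* The standard grading is the one induced by the degree of polynomials. *)
Definition homogeneous (d : nat) (f : edge_ring) : Prop :=
  exists2 p : S, p \is d.-homog & f = edge_pi p.

Definition homogeneous_ideal (J : edge_ring -> Prop) : Prop :=
  is_ideal J /\
  forall f, J f -> ideal_gen (fun g => J g /\ exists d, homogeneous d g) f.

Definition var_ideal : S -> Prop := ideal_gen (fun p => exists i, p = 'X_i).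

Definition mbar (f : edge_ring) : Prop :=
  exists2 p, var_ideal p & f = edge_pi p.

(* [mu_eq J d] : mu(J) = d. *)
Definition mu_eq (J : edge_ring -> Prop) (d : nat) : Prop :=
  dim_quot J (ideal_mul mbar J) d.

(* Ideals J with [mu_eq J d] for no d (mu(J) infinite) do not affect the
   minimum [ms]; none exist, as the edge ring is noetherian. *)
Definition ms_admissible (J : edge_ring -> Prop) : Prop :=
  [/\ homogeneous_ideal J, forall f, J f -> mbar f
    & forall f, ideal_mul mbar mbar f -> J f].

Definition ms_value (d : nat) : bool :=
  `[< exists J, ms_admissible J /\ mu_eq J d >].

Lemma mbarE f : mbar f <-> ideal_gen (fun g => exists i, g = edge_pi 'X_i) f.
Proof.
split=> [[p [m [a [s [Ss ->]]]] ->]|[m [a [s [Ss ->]]]]].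
  exists m, (fun i => edge_pi (a i)), (fun i => edge_pi (s i)); split.
    by move=> i; have [j ->] := Ss i; exists j.
  by rewrite raddf_sum; apply: eq_bigr => i _; rewrite /= rmorphM.
have [t ts] := choice Ss; have [b ba] := choice (fun i => edge_pi_surj (a i)).
exists (\sum_i b i * 'X_(t i)).
  by exists m, b, (fun i => 'X_(t i)); split=> // i; exists (t i).
by rewrite raddf_sum; apply: eq_bigr => i _; rewrite /= rmorphM /= ba ts.
Qed.

Lemma mbar_ideal : is_ideal mbar.
Proof.
have [I0 ID IM] := ideal_gen_ideal (fun g => exists i, g = edge_pi 'X_i).
split; first exact/mbarE.
  by move=> f g /mbarE If /mbarE Ig; apply/mbarE/ID.
by move=> a f /mbarE If; apply/mbarE/IM.
Qed.

Lemma mbar_admissible : ms_admissible mbar.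
Proof.
have mI := mbar_ideal; have [_ _ mM] := mI.
split=> //; last first.
  by move=> f; apply: ideal_gen_min => // _ [g [h [_ mh ->]]]; apply: mM.
split=> // f /mbarE; apply: ideal_gen_min; first exact: ideal_gen_ideal.
move=> _ [i ->]; apply: ideal_gen_sub; split.
  by apply/mbarE/ideal_gen_sub; exists i.
by exists 1%N, 'X_i => //; rewrite dhomogX /= mdeg1.
Qed.

Lemma sub_const_var_ideal (p : S) :
  exists c : k, var_ideal (p - c%:MP).
Proof.
have [V0 VD VM] := ideal_gen_ideal (fun p : S => exists i, p = 'X_i).
elim/mpolyind: p => [|c m p _ _ [d Vd]].
  by exists 0; rewrite mpolyC0 subr0.
have [->|m0] := eqVneq m 0%MM.
  exists (c + d); rewrite mpolyX0 -mul_mpolyC mulr1 mpolyCD.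
  by rewrite opprD addrACA subrr add0r.
have [i mi] : exists i, (0 < m i)%N.
  apply/existsP; apply: contraNT m0; rewrite negb_exists => /forallP m0.
  by apply/eqP/mnmP => i; rewrite mnm0E; apply/eqP; rewrite -leqn0 leqNgt.
exists d; rewrite -addrA; apply: VD => //.
have -> : m = (m - U_(i) + U_(i))%MM.
  by apply/esym/submK/mnm_lepP => j; rewrite mnm1E; case: eqVneq => // <-.
rewrite mpolyXD -mul_mpolyC mulrA; apply/VM/ideal_gen_sub; by exists i.
Qed.

(* The coefficient of 'X_i in p. *)
Local Notation lin i p := ((mderiv i p).@[fun=> 0]).

Lemma linM i (p q : S) :
  lin i (p * q) = lin i p * q.@[fun=> 0] + p.@[fun=> 0] * lin i q.
Proof. by rewrite mderivM mevalD !mevalM. Qed.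

Lemma linX i j : lin i ('X_j : S) = (i == j)%:R.
Proof.
rewrite mderivX mevalZ mevalX mnm1E eq_sym.
case: eqVneq => [->|_]; last by rewrite mul0r.
by rewrite mul1r big1 // => l _; rewrite mnmBE subnn expr0.
Qed.

Lemma lin_sum i m (F : 'I_m -> S) :
  lin i (\sum_j F j) = \sum_j lin i (F j).
Proof. by rewrite (raddf_sum (mderiv i)) (raddf_sum (meval _)). Qed.

Lemma lin_edge i (p : S) : ideal_gen edge_gen p -> lin i p = 0.
Proof.
move=> [m [a [s [Ss ->]]]]; rewrite lin_sum big1 // => l _.
have [u [v [_ ->]]] := Ss l.
by rewrite !linM !mevalM !mevalXU !(mulr0, mul0r, addr0).
Qed.

Lemma var_ideal_eval0 (p : S) : var_ideal p -> p.@[fun=> 0] = 0.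
Proof.
move=> [m [a [s [Ss ->]]]]; rewrite raddf_sum big1 // => l _ /=.
by have [u ->] := Ss l; rewrite mevalM mevalXU mulr0.
Qed.

Lemma lin_mbar2 f : ideal_mul mbar mbar f ->
  exists p, [/\ f = edge_pi p, p.@[fun=> 0] = 0 & forall i, lin i p = 0].
Proof.
pose J (g : edge_ring) := exists p,
  [/\ g = edge_pi p, p.@[fun=> 0] = 0 & forall i, lin i p = 0].
apply: (ideal_gen_min (J := J)) => [|_ [_ [_ [[p /var_ideal_eval0 p0 ->]
                                   [q /var_ideal_eval0 q0 ->] ->]]]].
  split.
  - by exists 0; split=> [||i]; rewrite ?raddf0.
  - move=> _ _ [p [-> p0 pl]] [q [-> q0 ql]]; exists (p + q).
    split=> [||i]; first by rewrite raddfD.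
      by rewrite mevalD p0 q0 addr0.
    by rewrite mderivD mevalD pl ql addr0.
  - move=> a _ [p [-> p0 pl]]; have [b ->] := edge_pi_surj a.
    exists (b * p); split=> [||i]; first by rewrite rmorphM.
      by rewrite mevalM p0 mulr0.
    by rewrite linM p0 pl !mulr0 addr0.
exists (p * q); split=> [||i]; first by rewrite rmorphM.
  by rewrite mevalM p0 mul0r.
by rewrite linM p0 q0 mulr0 mul0r addr0.
Qed.

Lemma mbar_mu : mu_eq mbar n.
Proof.
have [M0 MD MM] := ideal_gen_ideal
  (fun f => exists g h, [/\ mbar g, mbar h & f = g * h]).
have mX i : mbar (edge_pi 'X_i).
  by apply/mbarE/ideal_gen_sub; exists i.
exists (fun i => edge_pi 'X_i); split=> // f /mbarE mf.
suff [c Mc] : exists c : {ffun 'I_n -> k},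
    ideal_mul mbar mbar (f - \sum_i c i *: edge_pi 'X_i).
  exists c; split=> // d Md; apply/ffunP => i.
  have := MD _ _ Mc (MM (-1) _ Md).
  rewrite mulN1r opprB addrC addrA subrK => /lin_mbar2[p [pE _ pl]].
  have : edge_pi (\sum_j (c j - d j)%:MP * 'X_j + p) = 0.
    rewrite raddfD /= -pE raddf_sum -sumrB -big_split big1 //= => j _.
    rewrite rmorphM /= -[edge_pi _ * _]/((c j - d j) *: edge_pi 'X_j).
    by rewrite scalerBl addrA subrK subrr.
  move/edge_pi_eq0/(lin_edge i).
  rewrite mderivD mevalD pl addr0 lin_sum (bigD1 i) //= big1 => [|j ji].
    rewrite linM linX eqxx mevalC mderivC meval0 mul0r add0r addr0 mulr1.
    by move/eqP; rewrite subr_eq0 => /eqP.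
  by rewrite linM linX mevalC mderivC meval0 mul0r add0r eq_sym (negPf ji) mulr0.
case: mf => m [a [s [Ss ->]]].
have [t ts] := choice Ss.
have E l : exists c : k, mbar (a l - edge_pi c%:MP).
  have [p ->] := edge_pi_surj (a l); have [c vc] := sub_const_var_ideal p.
  by exists c; exists (p - c%:MP); rewrite ?raddfB.
have [c mc] := choice E.
exists [ffun i => \sum_(l | t l == i) c l].
have -> : \sum_i [ffun i => \sum_(l | t l == i) c l] i *: edge_pi 'X_i =
    \sum_l c l *: edge_pi 'X_(t l).
  rewrite [RHS](partition_big t xpredT) //=; apply: eq_bigr => i _.
  by rewrite ffunE scaler_suml; apply: eq_bigr => l /eqP ->.
rewrite -sumrB; elim/big_ind: _ => // l _.
rewrite ts -[c l *: _]/(edge_pi (c l)%:MP * _) -mulrBl.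
by apply: ideal_gen_sub; exists (a l - edge_pi (c l)%:MP), (edge_pi 'X_(t l)).
Qed.

Lemma ms_value_ex : exists d, ms_value d.
Proof.
by exists n; apply/asboolP; exists mbar; split;
  [exact: mbar_admissible | exact: mbar_mu].
Qed.

Definition ms : nat := ex_minn ms_value_ex.

Definition is_edge (A : {set 'I_n}) : Prop :=
  exists u v, e u v /\ A = [set u; v].

Definition edge_cover (l : nat) (E : 'I_l -> {set 'I_n}) : Prop :=
  (forall i, is_edge (E i)) /\ \bigcup_i E i = [set: 'I_n].

Definition clique_adjacent (A B : {set 'I_n}) : Prop :=
  (exists v w, [/\ v \in A, w \in B & e v w]) \/ A :&: B != set0.

Definition K_connected (l : nat) (E : 'I_l -> {set 'I_n}) : Prop :=
  forall i j, i != j -> clique_adjacent (E i) (E j).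

End EdgeRing.

Arguments ms : clear implicits.

(* Main.v *)
Require Import Defs.
From mathcomp Require Import all_boot all_order all_algebra.
From mathcomp Require Import boolp.
From mathcomp Require mpoly.

(** Write the edges of the cover as {u_i, v_i} and let J be generated by the
    linear forms f_i = x_(u_i) + x_(v_i). Since x_(u_i) x_(v_i) = 0, the products
    of f_i with these two variables are their squares. If v_i w is an edge, with
    {w, z} the j-th edge of the cover, then f_i x_w = x_(u_i) x_w,
    f_j x_(v_i) = x_(v_i) x_z, and f_i x_z = x_(u_i) x_z modulo the latter, so
    every product of a vertex of the i-th edge with a vertex of the j-th lies in
    J. Hence J contains the square of the maximal ideal, and J has l generators. *)

Set Implicit Arguments.
Unset Strict Implicit.
Unset Printing Implicit Defensive.

Import GRing.Theory.

Section QuotientDimension.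
Local Open Scope ring_scope.

Lemma spanning_dim_quot (k : fieldType) (M : lmodType k) (V W : M -> Prop)
    (WD : forall f g, W f -> W g -> W (f + g))
    (WZ : forall a f, W f -> W (a *: f))
    (l : nat) (b : 'I_l -> M) (Vb : forall i, V (b i))
    (b_span : forall f, V f -> exists c : 'I_l -> k, W (f - \sum_i c i *: b i)) :
  exists2 d, (d <= l)%N & dim_quot V W d.
Proof.
elim: l b Vb b_span => [|l IHl] b Vb b_span.
  exists 0%N => //; exists b; split=> // f /b_span[c Wc].
  exists [ffun i => c i]; split=> [|d _]; last by apply/ffunP; case.
  by under eq_bigr => i _ do rewrite ffunE.
have [[c [i ci0 Wc]]|b_free] := pselect
    (exists c : 'I_l.+1 -> k, exists2 i, c i != 0 & W (\sum_i c i *: b i)).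
  have [j|f Vf|d dl Vd] := IHl (b \o lift i) => /=; first exact: Vb.
    have [a Wa] := b_span f Vf.
    (* Subtracting [a i / c i] times the relation from the expansion of [f] cancels [b i]. *)
    exists (fun j => a (lift i j) - a i / c i * c (lift i j)).
    have := WD _ _ Wa (WZ (a i / c i) _ Wc).
    congr W; rewrite (bigD1_ord i) //= [in X in _ + X](bigD1_ord i) //=.
    rewrite scalerDr scalerA divfK // [X in f - X]addrC opprD !addrA subrK.
    rewrite -addrA scaler_sumr -!sumrN -big_split.
    congr (_ + _); apply: eq_bigr => j _.
    by rewrite scalerBl scalerA opprB addrC.
  by exists d => //; apply: leqW.
exists l.+1 => //; exists b; split=> // f /b_span[c Wc].
exists [ffun i => c i]; split=> [|d Wd].
  by under eq_bigr => i _ do rewrite ffunE.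
(* Two distinct expansions of [f] would differ by a relation that [b_free] excludes. *)
apply/ffunP => i; rewrite ffunE; apply/eqP; rewrite -subr_eq0; apply/negP => /negP cd.
case: b_free; exists (fun i => c i - d i), i => //.
have := WD _ _ Wd (WZ (-1) _ Wc); congr W.
rewrite scaleN1r opprB addrC addrA subrK -sumrB.
by apply: eq_bigr => j _; rewrite scalerBl.
Qed.

End QuotientDimension.

Section EdgeForms.
(* [mpoly] shadows [symmetric], so it must not be imported globally. *)
Import mpoly.
Local Open Scope ring_scope.
Variables (k : fieldType) (n : nat) (e : rel 'I_n).
Local Notation R := (edge_ring k e).
Local Notation x i := (edge_pi e ('X_i : {mpoly k[n]})).

Definition edge_form (i j : 'I_n) : R := x i + x j.

Lemma edge_pi_mulX i j : e i j -> x i * x j = 0.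
Proof.
move=> eij; rewrite -rmorphM; apply/edge_pi_eq0/ideal_gen_sub.
by exists i, j.
Qed.

Lemma mbarX i : mbar (x i).
Proof. by apply/mbarE/ideal_gen_sub; exists i. Qed.

Lemma mbar_mul_sub (J : R -> Prop) (J_ideal : is_ideal J)
    (JX : forall i j, J (x i * x j)) f :
  ideal_mul (@mbar k n e) (@mbar k n e) f -> J f.
Proof.
have [J0 JD JM] := J_ideal.
(* The colon ideal of [J] by [g] lets each factor be reduced to the variables in turn. *)
have colon g : is_ideal (fun h => J (h * g)).
  split=> [|h1 h2 Jh1 Jh2|a h Jh]; first by rewrite mul0r.
  - by rewrite mulrDl; apply: JD.
  - by rewrite -mulrA; apply: JM.
apply: ideal_gen_min => // _ [g [h [/mbarE mg /mbarE mh ->]]].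
apply: (ideal_gen_min (colon h)) mg => _ [i ->]; rewrite mulrC.
by apply: (ideal_gen_min (colon (x i))) mh => _ [j ->].
Qed.

Lemma edge_pi_sub_const (f : R) : exists c : k, mbar (f - edge_pi e c%:MP).
Proof.
have [p ->] := edge_pi_surj f; have [c vc] := sub_const_var_ideal p.
by exists c; exists (p - c%:MP); rewrite ?raddfB.
Qed.

(** Every ring element is a constant modulo [mbar], so the generators span the quotient over [k]. *)
Lemma mu_ideal_gen_le (l : nat) (f : 'I_l -> R) (S := fun g => exists i, g = f i) :
  exists2 d, (d <= l)%N & mu_eq (ideal_gen S) d.
Proof.
have [mJ0 mJD mJM] := ideal_gen_ideal
  (fun g => exists a h, [/\ mbar a, ideal_gen S h & g = a * h]).
apply: (spanning_dim_quot mJD _ (b := f)) .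
- by move=> a g; apply: mJM.
- by move=> i; apply: ideal_gen_sub; exists i.
move=> _ [m [a [s [Ss ->]]]].
have [t ts] := choice Ss; have [c mc] := choice (fun i => edge_pi_sub_const (a i)).
(* A generator may occur several times among the [s j], so the constant parts are collected along
   the fibres of [t]. *)
exists (fun i => \sum_(j | t j == i) c j).
have -> : \sum_i (\sum_(j | t j == i) c j) *: f i = \sum_j c j *: s j.
  rewrite [RHS](partition_big t xpredT) //=; apply: eq_bigr => i _.
  by rewrite scaler_suml; apply: eq_bigr => j /eqP <-; rewrite ts.
rewrite -sumrB; elim/big_ind: _ => // j _.
rewrite -[c j *: _]/(edge_pi _ (c j)%:MP * _) -mulrBl.
apply: ideal_gen_sub; exists (a j - edge_pi e (c j)%:MP), (s j).
by split=> //; apply: ideal_gen_sub.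
Qed.

(* [u] and [v] are the endpoints of one cover edge, [w] and [z] of another. *)
Lemma adjacent_forms_mul (J : R -> Prop) (J_ideal : is_ideal J) u v w z
    (evw : e v w) (Juv : J (x u + x v)) (Jwz : J (x w + x z)) :
  [/\ J (x u * x w), J (x u * x z), J (x v * x w) & J (x v * x z)].
Proof.
have [J0 JD JM] := J_ideal; have vw0 := edge_pi_mulX evw.
have Jvz : J (x v * x z) by have := JM (x v) _ Jwz; rewrite mulrDr vw0 add0r.
split; rewrite ?vw0 //.
  by have := JM (x w) _ Juv; rewrite mulrDr ![x w * _]mulrC vw0 addr0.
have := JD _ _ (JM (x z) _ Juv) (JM (-1) _ Jvz).
by rewrite mulrDr ![x z * _]mulrC mulN1r addrK.
Qed.

Lemma cover_forms_admissible (e_sym : ssrbool.symmetric e) (l : nat)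
    (X : 'I_l -> {set 'I_n}) (u v : 'I_l -> 'I_n)
    (uv : forall i, e (u i) (v i) /\ X i = [set u i; v i])
    (Xfull : \bigcup_i X i = [set: 'I_n]) (X_conn : K_connected e X) :
  ms_admissible (ideal_gen (fun g => exists i, g = edge_form (u i) (v i))).
Proof.
set S := fun g => _.
have J_ideal := ideal_gen_ideal S.
have [_ mD _] := mbar_ideal k e.
have Jf i : ideal_gen S (edge_form (u i) (v i)) by apply: ideal_gen_sub; exists i.
split.
- split=> // g; apply: ideal_gen_min => [|_ [i ->]]; first exact: ideal_gen_ideal.
  apply: ideal_gen_sub; split=> //; exists 1%N, ('X_(u i) + 'X_(v i)).
    by apply: rpredD; rewrite dhomogX /= mdeg1.
  by rewrite raddfD.
- move=> g; apply: ideal_gen_min => [|_ [i ->]]; first exact: mbar_ideal.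
  by apply: mD; apply: mbarX.
(* Either endpoint of a cover edge may be listed first, since both [e] and the form are
   symmetric. *)
have Jsub i a (ai : a \in X i) :
    exists b, [/\ b \in X i, e a b, X i = [set a; b] & ideal_gen S (x a + x b)].
  have [euv Xi] := uv i; move: ai; rewrite {1}Xi !inE => /orP[]/eqP->.
    by exists (v i); rewrite Xi !inE eqxx orbT; split=> //; apply: Jf.
  exists (u i); rewrite Xi !inE eqxx e_sym; split=> //; first by rewrite setUC.
  by rewrite addrC; apply: Jf.
have Jadj i j a b : (exists a' b', [/\ a' \in X i, b' \in X j & e a' b']) ->
    a \in X i -> b \in X j -> ideal_gen S (x a * x b).
  move=> [a' [b' [a'i b'j ea'b']]].
  have [a'' [_ _ Xi Ja]] := Jsub _ _ a'i; have [b'' [_ _ Xj Jb]] := Jsub _ _ b'j.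
  (* The endpoint [a'], adjacent to [b'], must come second in its form to play the role of [v]. *)
  rewrite addrC in Ja.
  have [] := adjacent_forms_mul J_ideal ea'b' Ja Jb.
  by rewrite Xi Xj !inE => ? ? ? ? /orP[]/eqP-> /orP[]/eqP->.
have Jmeet i j c a b : c \in X i -> c \in X j ->
    a \in X i -> b \in X j -> ideal_gen S (x a * x b).
  (* The other end of the j-th edge at c is adjacent to c, which lies on the i-th. *)
  move=> ci cj; have [c' [c'j ecc' _ _]] := Jsub _ _ cj.
  by move=> ai bj; apply: Jadj ai bj; exists c, c'.
move=> g; apply: mbar_mul_sub => // a b.
have [/bigcupP[i _ ai] /bigcupP[j _ bj]] :
  a \in \bigcup_i X i /\ b \in \bigcup_i X i by rewrite Xfull !inE.
(* [X_conn] says nothing when [i = j]; there the edge meets itself at [a]. *)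
have [ij|/X_conn[|/set0Pn[c]]] := eqVneq i j.
- by apply: (Jmeet i j a a b ai _ ai bj); rewrite -ij.
- by move=> ?; apply: Jadj ai bj.
- by rewrite inE => /andP[ci cj]; exact: (Jmeet i j c a b).
Qed.

End EdgeForms.

Theorem proposition6p36 (k : fieldType) (n : nat) (e : rel 'I_n)
    (e_sym : symmetric e) (e_irr : irreflexive e)
    (l : nat) (X : 'I_l -> {set 'I_n})
    (X_cover : edge_cover e X) (X_conn : K_connected e X) :
  ms k n e <= l.
Proof.
have [/choice[u /choice[v uv]] Xfull] := X_cover.
have Jadm := cover_forms_admissible k e_sym uv Xfull X_conn.
have [d dl Jd] := mu_ideal_gen_le (fun i => edge_form k e (u i) (v i)).
rewrite /ms; case: ex_minnP => m _ /(_ d) md; apply: leq_trans dl.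
by apply: md; apply/asboolP; eexists; split; [exact: Jadm | exact: Jd].
Qed.
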